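(* Every $3$-fold covering of the plane by a finite set of closed half-planes is decomposable into two covers. That is, if $\mathcal{H}$ is a finite set of closed half-planes in $\mathbb{R}^2$ such that every point of $\mathbb{R}^2$ belongs to at least three members of $\mathcal{H}$, then $\mathcal{H}$ can be partitioned into two parts $\mathcal{H}_1,\mathcal{H}_2$ such that every point of $\mathbb{R}^2$ belongs to at least one member of $\mathcal{H}_1$ and to at least one member of $\mathcal{H}_2$.
   Context: A $3$-fold covering of the plane by a set $\mathcal{H}$ of half-planes means that every point of $\mathbb{R}^2$ is contained in at least three members of $\mathcal{H}$. A cover is a set of half-planes whose union is $\mathbb{R}^2$. Decomposable into two covers means that the set can be partitioned into two subsets, each of which is a cover of the plane. *)

(* Defs.v *)
From mathcomp Require Import all_boot all_order all_algebra.
From mathcomp Require Import all_classical all_reals.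
Set Implicit Arguments.
Unset Strict Implicit.
Unset Printing Implicit Defensive.
Local Open Scope classical_set_scope.
Local Open Scope ring_scope.
Local Open Scope card_scope.

Definition closed_half_plane (R : realType) (A : set (R * R)) : Prop :=
  exists a b c : R,
    (a, b) <> (0, 0) /\ A = [set p : R * R | a * p.1 + b * p.2 <= c].

(* [`I_k #<= X] says that X has at least k elements. Members of H are counted
   as sets of points, so a half-plane given by two different inequalities is
   counted once. *)
Definition fold_covering (T : Type) (k : nat) (H : set (set T)) : Prop :=
  forall p : T, `I_k #<= [set A | H A /\ A p].

Definition is_cover (T : Type) (H : set (set T)) : Prop :=
  \bigcup_(A in H) A = setT.

(* Two parts that are covers of a nonempty space are nonempty. *)
Definition decomposable_into_two_covers (T : Type) (H : set (set T)) : Prop :=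
  exists H1 H2 : set (set T),
    [/\ H1 `|` H2 = H, H1 `&` H2 = set0, is_cover H1 & is_cover H2].

(* Main.v *)
Require Import Defs.
From mathcomp Require Import all_boot all_order all_algebra.
From mathcomp Require Import all_classical all_reals.
From mathcomp Require Import zify ring lra.
Set Implicit Arguments.
Unset Strict Implicit.
Unset Printing Implicit Defensive.
Import Order.TTheory GRing.Theory Num.Theory.
Local Open Scope classical_set_scope.
Local Open Scope ring_scope.

(** A family of half-planes covers the plane as soon as some nontrivial
    combination of their affine functions, with nonnegative coefficients, is a
    nonnegative constant; all the covers built below have this form.

    Suppose that [H] is not decomposable.  Being 3-fold, [H] still covers
    after the removal of two members ([survives_two_removals]), so no two
    members cover the plane.  By Helly's theorem three members do
    ([helly_cover]).  Choose such [A], [B], [C] with [A `&` B `&` C] minimal for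
    inclusion.  The other members do not cover, so some point [p] lies in [A],
    [B] and [C] and in nothing else ([critical_triple]).

    As no two of them cover, [A], [B], [C] either are the three sides of a
    nondegenerate triangle [abc] ([frame]) or have concurrent boundaries
    ([frame_or_concurrent]).  In the latter case [p] is on all the boundaries,
    and points next to [p] outside [B] and [C] are covered at most once.

    In barycentric coordinates every affine function is given by its values at
    [a], [b], [c].  Let [D] be another member.  If its function is largest at
    [a] and nonnegative there, then [D], [B], [C] cover ([frame_exchange]);
    were [D] to contain neither [b] nor [c], their intersection would be
    smaller than the triangle ([frame_exchange_shrinks]), against minimality.
    So a member other than [A], [B], [C] that meets the triangle contains
    exactly two vertices (not all three since it avoids [p]).  Points just
    beyond an edge are outside one of [A], [B], [C], hence in some other
    member; considering them where the line from the opposite vertex through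
    [p] leaves the triangle gives, for each edge, a member containing its two
    ends but not the third vertex ([edge_half_plane]): [D] for [ab], [E] for
    [bc], [F] for [ca].

    Orient each edge by asking at which of its two ends the function of its
    half-plane is larger.  If [D] prefers [a] and [E] prefers [b], then
    [D], [B], [C] cover by the exchange, and [A], [E], [F] cover by
    [opposite_side_cover].  Two of the three edges agree in orientation around
    the triangle, so up to symmetry this always happens
    ([frame_decomposable]). *)

(** * Half-planes as affine functions *)

Definition aff (R : realType) (k : R * R * R) (p : R * R) : R :=
  k.1.1 * p.1 + k.1.2 * p.2 + k.2.

Definition half_plane (R : realType) (k : R * R * R) : set (R * R) :=
  [set p | 0 <= aff k p].

Lemma closed_half_planeP (R : realType) (A : set (R * R)) :
  closed_half_plane A -> exists k, A = half_plane k.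
Proof.
move=> [a [b [c [_ ->]]]]; exists (- a, - b, c).
rewrite /half_plane /aff; apply/seteqP; split=> p /= h; lra.
Qed.

Lemma not_half_plane (R : realType) (k : R * R * R) (p : R * R) :
  ~ half_plane k p <-> aff k p < 0.
Proof. by rewrite /half_plane /= ltNge; split=> /negP. Qed.

(** Meant for weights of sum 1, when it is the point with barycentric
    coordinates [x], [y], [z]. *)
Definition comb (R : realType) (x : R) (a : R * R) (y : R) (b : R * R)
    (z : R) (c : R * R) : R * R :=
  (x * a.1 + y * b.1 + z * c.1, x * a.2 + y * b.2 + z * c.2).

Lemma aff_comb (R : realType) (k : R * R * R) (a b c : R * R) (x y z : R) :
  x + y + z = 1 ->
  aff k (comb x a y b z c) = x * aff k a + y * aff k b + z * aff k c.
Proof.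
move=> s1; rewrite /aff /comb /=; have -> : z = 1 - x - y by rewrite -s1; ring.
ring.
Qed.

(** Strict inequalities are open conditions; as the family is finite, one step
    size serves for all its members. *)
Lemma exists_strict_perturbation (R : realType) (s : seq (R * R * R))
    (u v : R * R) :
  (forall k, k \in s -> aff k u < 0) ->
  exists2 e : R, 0 < e &
    forall k, k \in s -> aff k (comb (1 - e) u e v 0 u) < 0.
Proof.
elim: s => [|k s IH] neg; first by exists 1.
have [|e e0 He] := IH.
  by move=> k' k's; apply: neg; rewrite inE k's orbT.
have ku : aff k u < 0 by apply: neg; rewrite inE eqxx.
pose N := 2 * (1 + `|aff k v - aff k u|).
have N0 : 0 < N by rewrite mulr_gt0 // ltr_pwDl.
pose d := Num.min e (- aff k u / N).
have d0 : 0 < d by rewrite lt_min e0 /= divr_gt0 ?oppr_gt0.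
have de : d <= e by rewrite ge_min lexx.
(* Moving by [d] changes the value of [k] by at most half of [- aff k u]. *)
have dk : d * N <= - aff k u by rewrite -ler_pdivlMr // ge_min lexx orbT.
exists d => // k'; rewrite inE => /orP[/eqP ->|k's].
  rewrite aff_comb; last ring.
  by have := ler_norm (aff k v - aff k u); rewrite /N in dk; nra.
have := He _ k's; have : aff k' u < 0 by apply: neg; rewrite inE k's orbT.
rewrite !aff_comb; [|ring|ring] => ku' He'.
(* The value at [d] is a convex combination of those at [0] and at [e]. *)
rewrite -(pmulr_rlt0 _ e0).
rewrite -(pmulr_rlt0 _ d0) in He'.
have : (e - d) * aff k' u <= 0 by rewrite mulr_ge0_le0 ?subr_ge0 // ltW.
lra.
Qed.

(** * Helly's theorem for covers by half-planes *)

Definition cover3 (T : Type) (A B C : set T) : Prop :=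
  forall p, [\/ A p, B p | C p].

(** Three homogeneous equations in four unknowns. *)
Lemma affine_dependency (R : realType) (P : 'I_4 -> R * R) :
  exists2 m : 'I_4 -> R, (exists i, m i != 0) &
    [/\ \sum_i m i = 0, \sum_i m i * (P i).1 = 0 & \sum_i m i * (P i).2 = 0].
Proof.
pose M := \matrix_(i < 4, j < 3)
  (if j == 0 then 1 else if j == 1 then (P i).1 else (P i).2).
have : kermx M != 0.
  rewrite -mxrank_eq0 mxrank_ker -lt0n subn_gt0.
  exact: leq_ltn_trans (rank_leq_col M) _.
move=> /rowV0Pn[v /sub_kermxP vM v0].
have vMj (j : 'I_3) : \sum_i v 0 i * M i j = 0.
  by have /matrixP/(_ 0 j) := vM; rewrite !mxE.
exists (fun i => v 0 i).
  move/rV0Pn: v0 => [i vi]; exists i; exact: vi.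
split.
- by rewrite -[RHS](vMj 0); apply: eq_bigr => i _; rewrite mxE /= mulr1.
- by rewrite -[RHS](vMj 1); apply: eq_bigr => i _; rewrite mxE.
- by rewrite -[RHS](vMj 2); apply: eq_bigr => i _; rewrite mxE.
Qed.

(** Radon's theorem in the form that Helly's argument consumes.  Split an affine
    dependency of the four points by sign: [q] lies in the convex hulls of two
    disjoint groups of points, and one of these groups avoids [P j]. *)
Lemma radon_point (R : realType) (P : 'I_4 -> R * R) :
  exists q, forall k j, (forall i, i != j -> aff k (P i) < 0) -> aff k q < 0.
Proof.
have [m [i0 mi0] [m0 m1 m2]] := affine_dependency P.
pose pos i := Num.max (m i) 0.
pose neg i := Num.max (- m i) 0.
have mE i : m i = pos i - neg i.
  by rewrite /pos /neg; case: leP => ?; case: leP => ?; lra.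
have pos0 i : 0 <= pos i by rewrite le_max lexx orbT.
have neg0 i : 0 <= neg i by rewrite le_max lexx orbT.
have sumE (F : 'I_4 -> R) : \sum_i m i * F i = 0 ->
    \sum_i pos i * F i = \sum_i neg i * F i.
  move=> h; have : \sum_i (pos i * F i - neg i * F i) = 0.
    by rewrite -[RHS]h; apply: eq_bigr => i _; rewrite -mulrBl mE.
  by rewrite sumrB => /subr0_eq.
have pnE : \sum_i pos i = \sum_i neg i.
  have : \sum_i (pos i - neg i) = 0.
    by rewrite -[RHS]m0; apply: eq_bigr => i _; rewrite mE.
  by rewrite sumrB => /subr0_eq.
pose s := \sum_i pos i.
have s0 : 0 < s.
  rewrite lt_def sumr_ge0 ?andbT //; apply/eqP => s0.
  have p0 : forall i, pos i = 0.
    by move=> i; apply: (psumr_eq0P (fun i _ => pos0 i) s0).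
  have n0 : forall i, neg i = 0.
    move=> i; apply: (psumr_eq0P (P := predT) (fun i _ => neg0 i)) => //.
    by rewrite -pnE.
  by move/eqP: mi0; apply; rewrite mE p0 n0 subrr.
pose q := (s^-1 * \sum_i pos i * (P i).1, s^-1 * \sum_i pos i * (P i).2).
have affq k (w : 'I_4 -> R) : \sum_i w i = s ->
    \sum_i w i * (P i).1 = \sum_i pos i * (P i).1 ->
    \sum_i w i * (P i).2 = \sum_i pos i * (P i).2 ->
    s * aff k q = \sum_i w i * aff k (P i).
  move=> w0 w1 w2; rewrite /aff /q /= -w1 -w2.
  under [RHS]eq_bigr do rewrite !mulrDr !(mulrCA (w _)).
  rewrite !big_split /= -!mulr_sumr -mulr_suml w0.
  by field; rewrite gt_eqF.
exists q => k j kneg.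
have step (w : 'I_4 -> R) : (forall i, 0 <= w i) -> \sum_i w i = s ->
    w j = 0 -> s * aff k q = \sum_i w i * aff k (P i) -> aff k q < 0.
  move=> w0 ws wj eq; rewrite -(pmulr_rlt0 _ s0) eq.
  have le0 i : w i * aff k (P i) <= 0.
    have [->|/kneg] := eqVneq i j; first by rewrite wj mul0r.
    by move=> /ltW; apply: mulr_ge0_le0.
  rewrite lt_def sumr_le0 ?andbT // eq_sym; apply/eqP => sum0.
  have all0 i : w i = 0.
    have : - (w i * aff k (P i)) = 0.
      apply: (psumr_eq0P (P := predT) (F := fun i => - (w i * aff k (P i)))) => //.
        by move=> i' _; rewrite oppr_ge0.
      by rewrite sumrN sum0 oppr0.
    move/eqP; rewrite oppr_eq0 mulf_eq0 => /orP[/eqP//|/eqP ki].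
    have [->//|/kneg] := eqVneq i j; by rewrite ki ltxx.
  by move: s0; rewrite -ws big1 ?ltxx.
have [mj|mj] := leP (m j) 0.
  apply: (step pos) => //; last exact: affq.
  by rewrite /pos; apply/max_idPr.
apply: (step neg) => //; first by rewrite /neg; apply/max_idPr; rewrite oppr_le0 ltW.
by apply: affq; rewrite -?sumE.
Qed.

(** In a cover with the least number of members, every member has a point that
    it alone covers.  If there were four members, the Radon point of four such
    points would be covered by none. *)
Lemma helly_cover (R : realType) (s : seq (set (R * R))) :
  (forall A, A \in s -> exists k, A = half_plane k) ->
  (forall p, exists2 A, A \in s & A p) ->
  exists A B C, [/\ A \in s, B \in s, C \in s & cover3 A B C].
Proof.
move=> hs cov.
pose covering n := `[< exists t : seq (set (R * R)),
  [/\ size t = n, {subset t <= s} & forall p, exists2 A, A \in t & A p] >].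
have ex_cov : exists n, covering n.
  by exists (size s); apply/asboolP; exists s; split.
have [n covn nmin] := ex_minnP ex_cov.
move: covn => /asboolP[t [tn ts tcov]].
move: tn ts tcov; case: t => [|A [|B [|C [|D t]]]].
- by move=> _ _ /(_ (0, 0))[].
- move=> _ ts tcov; exists A, A, A.
  have As : A \in s by apply: ts; rewrite inE.
  split=> // p; have [Z] := tcov p; rewrite inE => /eqP-> Ap.
  by constructor 1.
- move=> _ ts tcov; exists A, B, B.
  have As : A \in s by apply: ts; rewrite inE eqxx.
  have Bs : B \in s by apply: ts; rewrite !inE eqxx orbT.
  split=> // p; have [Z] := tcov p; rewrite !inE => /orP[] /eqP-> Zp.
    by constructor 1.
  by constructor 2.
- move=> _ ts tcov; exists A, B, C.
  have [As Bs Cs] : [/\ A \in s, B \in s & C \in s].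
    by split; apply: ts; rewrite !inE eqxx ?orbT.
  split=> // p; have [Z] := tcov p; rewrite !inE => /or3P[] /eqP-> Zp.
  + by constructor 1.
  + by constructor 2.
  + by constructor 3.
move=> tn ts tcov; exfalso.
(* By minimality each of the first four members has a point of its own. *)
pose T := [:: A, B, C, D & t].
have private (i : 'I_4) :
    exists q, forall Z, Z \in take i T ++ drop i.+1 T -> ~ Z q.
  apply: contrapT => /forallNP hq.
  have iT : (i < size T)%N by rewrite (leq_trans (ltn_ord i)).
  suff : (n <= (size T).-1)%N by rewrite -tn /= ltnn.
  apply: nmin; apply/asboolP; exists (take i T ++ drop i.+1 T); split.
  - by rewrite size_cat size_take size_drop iT; lia.
  - move=> Z; rewrite mem_cat => /orP[/mem_take|/mem_drop]; exact: ts.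
  - move=> q; apply: contrapT => hZ; apply: (hq q) => Z Zin Zq.
    by apply: hZ; exists Z.
have [P hP] := choice private.
have [q hq] := radon_point P.
have [Z ZT Zq] := tcov q.
have [k Zk] := hs _ (ts _ ZT).
(* If [Z] is not among the first four members, any [j] would do. *)
pose j : 'I_4 := inord (minn (index Z T) 3).
have jE : j = minn (index Z T) 3 :> nat by rewrite inordK // ltnS geq_minr.
have : aff k q < 0.
  apply: (hq k j) => i ij; apply/not_half_plane; rewrite -Zk; apply: hP.
  have neq : i <> minn (index Z T) 3 :> nat.
    by move=> h; move/eqP: ij; apply; apply: val_inj; rewrite /= h jE.
  have iT : (index Z T < size T)%N by rewrite index_mem.
  have i4 := ltn_ord i.
  rewrite mem_cat; apply/orP.
  have [lt|ge] := ltnP (index Z T) i.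
    left; rewrite -(nth_index set0 ZT) -(nth_take set0 lt) mem_nth //.
    by rewrite size_take; case: ifP => // _.
  have gt : (i.+1 <= index Z T)%N by move: neq ge; rewrite /minn; case: ltnP; lia.
  right; rewrite -(nth_index set0 ZT) -(subnKC gt) -nth_drop mem_nth //.
  by rewrite size_drop ltn_sub2r // (leq_ltn_trans gt).
by move/not_half_plane; rewrite -Zk.
Qed.

(** * Barycentric coordinates in the triangle of a cover *)

(** [a], [b], [c] are the vertices of a nondegenerate triangle, and [A], [B],
    [C] are the half-planes bounded by the side opposite to [a], [b], [c]
    respectively and containing that vertex.  Coordinates instead of functions
    keep the notion symmetric under relabelling the vertices. *)
Definition frame (R : realType) (A B C : set (R * R)) (a b c : R * R) : Prop :=
  (forall p, exists x y z, x + y + z = 1 /\ p = comb x a y b z c) /\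
  (forall x y z, x + y + z = 1 ->
     [/\ A (comb x a y b z c) <-> 0 <= x,
         B (comb x a y b z c) <-> 0 <= y
       & C (comb x a y b z c) <-> 0 <= z]).

Lemma comb_rot (R : realType) (a b c : R * R) (x y z : R) :
  comb x a y b z c = comb y b z c x a.
Proof. by rewrite /comb; congr pair; ring. Qed.

Lemma comb_swap (R : realType) (a b c : R * R) (x y z : R) :
  comb x a y b z c = comb y b x a z c.
Proof. by rewrite /comb; congr pair; ring. Qed.

Lemma frame_rot (R : realType) (A B C : set (R * R)) (a b c : R * R) :
  frame A B C a b c -> frame B C A b c a.
Proof.
move=> [spn side]; split=> [p|y z x s1].
  have [x [y [z [s1 ->]]]] := spn p; exists y, z, x.
  by split; [rewrite -s1; ring|exact: comb_rot].
have s1' : x + y + z = 1 by rewrite -s1; ring.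
by rewrite -comb_rot; have [] := side _ _ _ s1'.
Qed.

Lemma frame_swap (R : realType) (A B C : set (R * R)) (a b c : R * R) :
  frame A B C a b c -> frame B A C b a c.
Proof.
move=> [spn side]; split=> [p|y x z s1].
  have [x [y [z [s1 ->]]]] := spn p; exists y, x, z.
  by split; [rewrite -s1; ring|exact: comb_swap].
have s1' : x + y + z = 1 by rewrite -s1; ring.
by rewrite -comb_swap; have [] := side _ _ _ s1'.
Qed.

(** With the barycentric coordinates [y] and [z], the function
    [d + (d a - d b) y + (d a - d c) z] is the constant [d a]. *)
Lemma frame_exchange (R : realType) (A B C : set (R * R)) (a b c : R * R)
    (d : R * R * R) :
  frame A B C a b c ->
  0 <= aff d a -> aff d b <= aff d a -> aff d c <= aff d a ->
  cover3 (half_plane d) B C.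
Proof.
move=> [spn side] da0 dba dca p; have [x [y [z [s1 ->]]]] := spn p.
have [_ By Cz] := side x y z s1.
have [y0|y0] := leP 0 y; first by constructor 2; apply/By.
have [z0|z0] := leP 0 z; first by constructor 3; apply/Cz.
constructor 1; rewrite /half_plane /= aff_comb //.
have -> : x = 1 - y - z by rewrite -s1; ring.
nra.
Qed.

Lemma frame_exchange_shrinks (R : realType) (A B C : set (R * R))
    (a b c : R * R) (d : R * R * R) :
  frame A B C a b c ->
  0 <= aff d a -> aff d b < 0 -> aff d c < 0 ->
  forall q, half_plane d q -> B q -> C q -> A q.
Proof.
move=> [spn side] da0 db dc q; have [x [y [z [s1 ->]]]] := spn q.
have [Ax By Cz] := side x y z s1.
rewrite /half_plane /= aff_comb // => dq /By y0 /Cz z0; apply/Ax.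
rewrite leNgt; apply/negP => x0.
have : 0 < y \/ 0 < z by have [|] := ltP 0 y; [left|right; lra].
have xa : x * aff d a <= 0 by rewrite nmulr_rle0.
by move=> [y1|z1]; nra.
Qed.

(** Some combination [m e + n f] takes the same value [t >= 0] at [b] and [c].
    It is negative at [p], a point of the triangle, so its value [r] at [a]
    cannot be positive, and adding [t - r] times the first barycentric
    coordinate, nonnegative exactly on [A], gives the constant [t].  The point
    [p] is essential: if [e] and [f] together contained the triangle, they
    could leave uncovered a wedge beyond [bc]. *)
Lemma opposite_side_cover (R : realType) (A B C : set (R * R))
    (a b c p : R * R) (e f : R * R * R) :
  frame A B C a b c -> A p -> B p -> C p ->
  0 <= aff e b -> 0 <= aff e c -> aff e c <= aff e b ->
  aff f b < 0 -> 0 <= aff f c ->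
  aff e p < 0 -> aff f p < 0 ->
  cover3 A (half_plane e) (half_plane f).
Proof.
move=> [spn side] + + + eb ec ecb fb fc.
have [x [y [z [s1 ->]]]] := spn p; have [Ax By Cz] := side x y z s1.
move=> /Ax x0 /By y0 /Cz z0; rewrite !aff_comb // => ep fp.
pose m := aff f c - aff f b; pose n := aff e b - aff e c.
have m0 : 0 < m by rewrite /m; lra.
have n0 : 0 <= n by rewrite /n; lra.
pose t := aff e b * aff f c - aff f b * aff e c.
have t0 : 0 <= t by rewrite /t; nra.
pose r := m * aff e a + n * aff f a.
have tb : m * aff e b + n * aff f b = t by rewrite /m /n /t; ring.
have tc : m * aff e c + n * aff f c = t by rewrite /m /n /t; ring.
have r0 : r <= 0.
  have : x * r + (y + z) * t < 0.
    have -> : x * r + (y + z) * t =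
        m * (x * aff e a + y * aff e b + z * aff e c) +
        n * (x * aff f a + y * aff f b + z * aff f c).
      by rewrite mulrDl -{1}tb -tc /r; ring.
    nra.
  move=> h; rewrite leNgt; apply/negP => r0; nra.
move=> q; have [x' [y' [z' [s1' ->]]]] := spn q.
have [Ax' _ _] := side _ _ _ s1'.
have [x'0|x'0] := leP 0 x'; first by constructor 1; apply/Ax'.
have [e0|e0] := leP 0 (aff e (comb x' a y' b z' c)); first by constructor 2.
have [f0|f0] := leP 0 (aff f (comb x' a y' b z' c)); first by constructor 3.
exfalso; move: e0 f0; rewrite !aff_comb // => e0 f0.
have : x' * r + (1 - x') * t < 0.
  have -> : x' * r + (1 - x') * t =
      m * (x' * aff e a + y' * aff e b + z' * aff e c) +
      n * (x' * aff f a + y' * aff f b + z' * aff f c).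
    have -> : 1 - x' = y' + z' by lra.
    by rewrite mulrDl -{1}tb -tc /r; ring.
  nra.
nra.
Qed.

(** * The triangle of a cover by three half-planes *)

(** Keeping the total weight as a factor avoids divisions in the computations
    below. *)
Lemma weighted_point (R : realType) (a b c : R * R) (x y z : R) :
  0 < x + y + z ->
  exists q, forall k,
    (x + y + z) * aff k q = x * aff k a + y * aff k b + z * aff k c.
Proof.
set s := x + y + z => s0; exists (comb (x / s) a (y / s) b (z / s) c) => k.
have s1 : x / s + y / s + z / s = 1 by rewrite -!mulrDl divff ?gt_eqF.
by rewrite aff_comb //; field; rewrite gt_eqF.
Qed.

Lemma cover3_nonneg (R : realType) (f g h : R * R * R) (p : R * R) :
  cover3 (half_plane f) (half_plane g) (half_plane h) ->
  aff g p < 0 -> aff h p < 0 -> 0 <= aff f p.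
Proof.
by move=> cov gp hp; case: (cov p); rewrite /half_plane //= leNgt ?gp ?hp.
Qed.

Lemma cover3_rot (T : Type) (A B C : set T) : cover3 A B C -> cover3 B C A.
Proof.
by move=> cov p; case: (cov p) => ?; [constructor 3|constructor 1|constructor 2].
Qed.

(** On the segment [ab] only [f] and [g] can cover.  The weights
    [g b - f b] and [f a - g a] give a point where both functions have the sign
    of the determinant. *)
Lemma cover_minor_ge0 (R : realType) (f g h : R * R * R) (a b : R * R) :
  cover3 (half_plane f) (half_plane g) (half_plane h) ->
  aff g a < 0 -> aff h a < 0 -> aff f b < 0 -> aff h b < 0 ->
  aff f b * aff g a <= aff f a * aff g b.
Proof.
move=> cov ga ha fb hb.
have fa := cover3_nonneg cov ga ha.
have gb := cover3_nonneg (cover3_rot cov) hb fb.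
rewrite leNgt; apply/negP => det0.
have [|q hq] := @weighted_point R a b b (aff g b - aff f b) (aff f a - aff g a) 0.
  lra.
have neg k : (aff g b - aff f b) * aff k a + (aff f a - aff g a) * aff k b < 0 ->
    aff k q < 0.
  have s0 : 0 < aff g b - aff f b + (aff f a - aff g a) + 0 by lra.
  by move=> h0; rewrite -(pmulr_rlt0 _ s0) hq mul0r addr0.
have fq : aff f q < 0 by apply: neg; lra.
have gq : aff g q < 0 by apply: neg; lra.
have hq' : aff h q < 0 by apply: neg; nra.
by have := cover3_nonneg cov gq hq'; rewrite leNgt fq.
Qed.

Lemma frame_of_vertices (R : realType) (f g h : R * R * R) (a b c : R * R) :
  0 < aff f a -> aff f b = 0 -> aff f c = 0 ->
  aff g a = 0 -> 0 < aff g b -> aff g c = 0 ->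
  aff h a = 0 -> aff h b = 0 -> 0 < aff h c ->
  frame (half_plane f) (half_plane g) (half_plane h) a b c.
Proof.
move=> fa fb fc ga gb gc ha hb hc; split=> [p|x y z s1]; last first.
  rewrite /half_plane /= !aff_comb // fb fc ga gc ha hb !mulr0 !addr0 !add0r.
  by split; rewrite pmulr_lge0.
(* The determinant of the values of [f] and [g] is that of their linear parts
   times [D], so [D] does not vanish and Cramer's rule applies. *)
pose D := (a.1 - c.1) * (b.2 - c.2) - (a.2 - c.2) * (b.1 - c.1).
have D0 : D != 0.
  apply/eqP => D0.
  have : (f.1.1 * g.1.2 - f.1.2 * g.1.1) * D =
      (aff f a - aff f c) * (aff g b - aff g c) -
      (aff f b - aff f c) * (aff g a - aff g c) by rewrite /aff /D; ring.
  by rewrite D0 fb fc ga gc !subr0 mulr0 mul0r subr0 => /esym/eqP;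
    rewrite mulf_eq0 !gt_eqF.
pose x := ((p.1 - c.1) * (b.2 - c.2) - (p.2 - c.2) * (b.1 - c.1)) / D.
pose y := ((a.1 - c.1) * (p.2 - c.2) - (a.2 - c.2) * (p.1 - c.1)) / D.
exists x, y, (1 - x - y); split; first ring.
rewrite [LHS]surjective_pairing /comb /x /y.
by congr pair; rewrite /D in D0 *; field.
Qed.

(** Consider the matrix of the values of [f], [g], [h] at the three points.  It
    is nonnegative on the diagonal and negative off it, and its principal
    2x2 minors are nonnegative, so its adjugate is nonnegative.  The columns of
    the adjugate are weights of the three vertices; the sum of the columns
    weights a point where the three functions have the sign of the determinant,
    which is therefore nonnegative, and null only in the concurrent case. *)
Lemma frame_or_concurrent (R : realType) (f g h : R * R * R) (pa pb pc : R * R) :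
  cover3 (half_plane f) (half_plane g) (half_plane h) ->
  aff g pa < 0 -> aff h pa < 0 -> aff f pb < 0 -> aff h pb < 0 ->
  aff f pc < 0 -> aff g pc < 0 ->
  (exists a b c, frame (half_plane f) (half_plane g) (half_plane h) a b c) \/
  (exists q, [/\ aff f q = 0, aff g q = 0 & aff h q = 0]).
Proof.
move=> cov ga ha fb hb fc gc.
have cov' := cover3_rot cov; have cov'' := cover3_rot cov'.
have fa := cover3_nonneg cov ga ha.
have gb := cover3_nonneg cov' hb fb.
have hc := cover3_nonneg cov'' fc gc.
have mfg := cover_minor_ge0 cov ga ha fb hb.
have mgh := cover_minor_ge0 cov' hb fb gc fc.
have mhf := cover_minor_ge0 cov'' fc gc ha ga.
(* The columns of the adjugate are [(a1, a2, a3)], [(b1, b2, b3)] and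
   [(c1, c2, c3)]. *)
pose a1 := aff g pb * aff h pc - aff g pc * aff h pb.
pose a2 := aff g pc * aff h pa - aff g pa * aff h pc.
pose a3 := aff g pa * aff h pb - aff g pb * aff h pa.
pose b1 := aff h pb * aff f pc - aff h pc * aff f pb.
pose b2 := aff h pc * aff f pa - aff h pa * aff f pc.
pose b3 := aff h pa * aff f pb - aff h pb * aff f pa.
pose c1 := aff f pb * aff g pc - aff f pc * aff g pb.
pose c2 := aff f pc * aff g pa - aff f pa * aff g pc.
pose c3 := aff f pa * aff g pb - aff f pb * aff g pa.
pose det := aff f pa * a1 + aff f pb * a2 + aff f pc * a3.
have a1_ge0 : 0 <= a1 by rewrite /a1; lra.
have b2_ge0 : 0 <= b2 by rewrite /b2; lra.
have c3_ge0 : 0 <= c3 by rewrite /c3; lra.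
have nn (x y : R) : x < 0 -> y < 0 -> 0 < x * y.
  by move=> x0 y0; rewrite nmulr_rgt0.
have np (x y : R) : x < 0 -> 0 <= y -> x * y <= 0.
  by move=> x0 y0; rewrite nmulr_rle0.
have a2_gt0 : 0 < a2.
  by rewrite /a2; have := nn _ _ gc ha; have := np _ _ ga hc; lra.
have a3_gt0 : 0 < a3.
  by rewrite /a3; have := nn _ _ ga hb; have := np _ _ ha gb; lra.
have b1_gt0 : 0 < b1.
  by rewrite /b1; have := nn _ _ hb fc; have := np _ _ fb hc; lra.
have b3_gt0 : 0 < b3.
  by rewrite /b3; have := nn _ _ ha fb; have := np _ _ hb fa; lra.
have c1_gt0 : 0 < c1.
  by rewrite /c1; have := nn _ _ fb gc; have := np _ _ fc gb; lra.
have c2_gt0 : 0 < c2.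
  by rewrite /c2; have := nn _ _ fc ga; have := np _ _ gc fa; lra.
have sa : 0 < a1 + a2 + a3 by lra.
have sb : 0 < b1 + b2 + b3 by lra.
have sc : 0 < c1 + c2 + c3 by lra.
have [a ha'] := @weighted_point R pa pb pc _ _ _ sa.
have [b hb'] := @weighted_point R pa pb pc _ _ _ sb.
have [c hc'] := @weighted_point R pa pb pc _ _ _ sc.
pose w1 := a1 + b1 + c1; pose w2 := a2 + b2 + c2; pose w3 := a3 + b3 + c3.
have sw : 0 < w1 + w2 + w3 by rewrite /w1 /w2 /w3; lra.
have [q hq] := @weighted_point R pa pb pc _ _ _ sw.
have qf : (w1 + w2 + w3) * aff f q = det.
  by rewrite hq /det /w1 /w2 /w3 /a1 /a2 /a3 /b1 /b2 /b3 /c1 /c2 /c3; ring.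
have qg : (w1 + w2 + w3) * aff g q = det.
  by rewrite hq /det /w1 /w2 /w3 /a1 /a2 /a3 /b1 /b2 /b3 /c1 /c2 /c3; ring.
have qh : (w1 + w2 + w3) * aff h q = det.
  by rewrite hq /det /w1 /w2 /w3 /a1 /a2 /a3 /b1 /b2 /b3 /c1 /c2 /c3; ring.
(* A negative determinant would leave [q] uncovered. *)
have [det_lt0|det_gt0|det0] := ltgtP det 0.
- have neg k : (w1 + w2 + w3) * aff k q = det -> aff k q < 0.
    by rewrite -(pmulr_rlt0 _ sw) => ->.
  have := cover3_nonneg cov (neg _ qg) (neg _ qh).
  by rewrite leNgt (neg _ qf).
- left; exists a, b, c.
  have pos (s : R) k r : 0 < s -> s * aff k r = det -> 0 < aff k r.
    by move=> s0 e; rewrite -(pmulr_rgt0 _ s0) e.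
  have zero (s : R) k r : 0 < s -> s * aff k r = 0 -> aff k r = 0.
    by move=> s0 /eqP; rewrite mulf_eq0 gt_eqF //= => /eqP.
  apply: frame_of_vertices.
  + by apply: (pos _ _ _ sa); rewrite ha' /det; ring.
  + by apply: (zero _ _ _ sb); rewrite hb' /b1 /b2 /b3; ring.
  + by apply: (zero _ _ _ sc); rewrite hc' /c1 /c2 /c3; ring.
  + by apply: (zero _ _ _ sa); rewrite ha' /a1 /a2 /a3; ring.
  + by apply: (pos _ _ _ sb); rewrite hb' /det /a1 /a2 /a3 /b1 /b2 /b3; ring.
  + by apply: (zero _ _ _ sc); rewrite hc' /c1 /c2 /c3; ring.
  + by apply: (zero _ _ _ sa); rewrite ha' /a1 /a2 /a3; ring.
  + by apply: (zero _ _ _ sb); rewrite hb' /b1 /b2 /b3; ring.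
  + by apply: (pos _ _ _ sc); rewrite hc' /det /a1 /a2 /a3 /c1 /c2 /c3; ring.
- right; exists q.
  have zero k : (w1 + w2 + w3) * aff k q = det -> aff k q = 0.
    by rewrite det0 => /eqP; rewrite mulf_eq0 gt_eqF //= => /eqP.
  by split; apply: zero.
Qed.

(** Otherwise the reflection of [p] through [q], moved slightly in the direction
    from [q] to [pa], would be outside the three half-planes. *)
Lemma concurrent_common_point (R : realType) (f g h : R * R * R)
    (pa p q : R * R) :
  cover3 (half_plane f) (half_plane g) (half_plane h) ->
  aff g pa < 0 -> aff h pa < 0 ->
  [/\ aff f q = 0, aff g q = 0 & aff h q = 0] ->
  half_plane f p -> half_plane g p -> half_plane h p -> aff f p = 0.
Proof.
rewrite /half_plane /= => cov ga ha [fq gq hq] fp gp hp.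
apply/eqP; rewrite eq_le fp andbT leNgt; apply/negP => fp0.
pose r := comb 2 q (-1) p 0 q.
have rE k : aff k q = 0 -> aff k r = - aff k p.
  by move=> kq; rewrite aff_comb ?kq; ring.
have [|e e0 He] := @exists_strict_perturbation R [:: f] r (comb 1 r 1 pa (-1) q).
  by move=> k; rewrite inE => /eqP ->; rewrite rE // oppr_lt0.
have := He f; rewrite inE eqxx => /(_ isT).
set s := comb _ _ _ _ _ _ => fs.
have sE k : aff k q = 0 -> aff k s = - aff k p + e * aff k pa.
  move=> kq; rewrite /s !aff_comb ?rE ?kq; ring.
have gs : aff g s < 0 by rewrite sE //; nra.
have hs : aff h s < 0 by rewrite sE //; nra.
by have := cover3_nonneg cov gs hs; rewrite leNgt fs.
Qed.

(** * Coverings that survive the removal of two members *)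

Definition survives_two_removals (T : Type) (H : set (set T)) : Prop :=
  forall X Y p, exists Z, [/\ H Z, Z p, Z <> X & Z <> Y].

Lemma fold_covering_survives (T : Type) (H : set (set T)) :
  fold_covering 3 H -> survives_two_removals H.
Proof.
move=> H3 X Y p; apply: contrapT => /forallNP none.
have XY Z : H Z -> Z p -> Z = X \/ Z = Y.
  move=> HZ Zp; have [->|ZX] := pselect (Z = X); first by left.
  have [->|ZY] := pselect (Z = Y); first by right.
  by case: (none Z).
have /pcard_leP[F] := H3 p.
have FS i : (i < 3)%N -> F i = X \/ F i = Y.
  by move=> i3; have [HF Fp] := @funS _ _ _ _ F i i3; apply: XY.
have Finj i j : (i < 3)%N -> (j < 3)%N -> F i = F j -> i = j.
  by move=> i3 j3; apply: inj; rewrite inE.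
have := Finj 0%N 1%N isT isT; have := Finj 0%N 2%N isT isT.
have := Finj 1%N 2%N isT isT.
by case: (FS 0%N isT) => ->; case: (FS 1%N isT) => ->;
  case: (FS 2%N isT) => -> h12 h02 h01;
  do [have := h12 erefl | have := h02 erefl | have := h01 erefl].
Qed.

Lemma decomposable_of_subcover (T : Type) (H H1 : set (set T)) :
  H1 `<=` H -> is_cover H1 ->
  (forall p, exists Z, [/\ H Z, ~ H1 Z & Z p]) ->
  decomposable_into_two_covers H.
Proof.
move=> H1H cov1 cov2; exists H1, (H `\` H1); split=> //.
- exact: setDUK.
- exact: setDIK.
- apply/seteqP; split=> // p _; have [Z [HZ nZ Zp]] := cov2 p.
  by exists Z.
Qed.

Lemma is_cover_triple (T : Type) (A B C : set T) :
  cover3 A B C -> is_cover [set Z | [\/ Z = A, Z = B | Z = C]].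
Proof.
move=> cov; apply/seteqP; split=> // p _; have [Ap|Bp|Cp] := cov p.
- by exists A => //; constructor 1.
- by exists B => //; constructor 2.
- by exists C => //; constructor 3.
Qed.

Lemma decomposable_of_triples (T : Type) (H : set (set T)) A B C A' B' C' :
  [/\ H A, H B & H C] -> [/\ H A', H B' & H C'] ->
  cover3 A B C -> cover3 A' B' C' ->
  [/\ A' <> A, A' <> B & A' <> C] -> [/\ B' <> A, B' <> B & B' <> C] ->
  [/\ C' <> A, C' <> B & C' <> C] ->
  decomposable_into_two_covers H.
Proof.
move=> [HA HB HC] [HA' HB' HC'] cov cov' [? ? ?] [? ? ?] [? ? ?].
apply: (@decomposable_of_subcover _ _ [set Z | [\/ Z = A, Z = B | Z = C]]).
- by move=> Z [] ->.
- exact: is_cover_triple.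
- by move=> p; have [Ap|Bp|Cp] := cov' p; [exists A'|exists B'|exists C'];
    split=> //; case.
Qed.

Lemma two_cover_decomposable (T : Type) (H : set (set T)) (X Y : set T) :
  survives_two_removals H ->
  H X -> H Y -> (forall p, X p \/ Y p) -> decomposable_into_two_covers H.
Proof.
move=> H3 HX HY cov.
apply: (@decomposable_of_subcover _ _ [set Z | Z = X \/ Z = Y]).
- by move=> Z [] ->.
- apply/seteqP; split=> // p _.
  by have [Xp|Yp] := cov p; [exists X => //; left|exists Y => //; right].
- move=> p; have [Z [HZ Zp ZX ZY]] := H3 X Y p; exists Z; split=> //; by case.
Qed.

Lemma finite_set_minimal (T : Type) (P : set (set T)) :
  finite_set P -> P !=set0 ->
  exists2 X, P X & forall Y, P Y -> Y `<=` X -> Y = X.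
Proof.
move=> /finite_seqP[s ->]; elim: s => [[X]//|X s IH _].
have [->|s0] := eqVneq s [::].
  by exists X => [|Y] /=; rewrite inE // => /eqP.
have [|M Ms Mmin] := IH.
  by case: s s0 {IH} => // Y s _; exists Y; rewrite /= inE eqxx.
have [XM|XM] := pselect (X `<=` M); last first.
  exists M => [|Y /=]; first by rewrite /= inE; apply/orP; right.
  by rewrite inE => /orP[/eqP->|Ys] // YM; apply: Mmin.
exists X => [|Y /=]; first by rewrite /= inE eqxx.
rewrite inE => /orP[/eqP->//|Ys] YX.
have YM := Mmin _ Ys (subset_trans YX XM).
by apply/seteqP; split=> //; rewrite YM.
Qed.

(** * Members meeting the triangle of a minimal cover *)

(** The last clause is the trace at [p] of the minimality of the intersection
    of [A], [B], [C] among the covering triples: a covering triple with a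
    smaller intersection has the same one.  Only its first member is mentioned;
    the others follow by relabelling [X], [Y], [Z]. *)
Definition critical_triple (T : Type) (H : set (set T)) (A B C : set T)
    (p : T) : Prop :=
  [/\ [/\ H A, H B & H C], [/\ A p, B p & C p],
      forall Z, H Z -> Z p -> [\/ Z = A, Z = B | Z = C]
    & forall X Y Z, H X -> H Y -> H Z -> cover3 X Y Z ->
        (forall q, X q -> Y q -> Z q -> [/\ A q, B q & C q]) -> X p].

Lemma critical_triple_rot (T : Type) (H : set (set T)) (A B C : set T) (p : T) :
  critical_triple H A B C p -> critical_triple H B C A p.
Proof.
move=> [[HA HB HC] [Ap Bp Cp] only least]; split=> //.
- move=> Z HZ /(only Z HZ)[]->; by [constructor 3|constructor 1|constructor 2].
- move=> X Y Z HX HY HZ cov sub; apply: (least X Y Z) => // q Xq Yq Zq.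
  by have [] := sub q Xq Yq Zq.
Qed.

Lemma critical_triple_swap (T : Type) (H : set (set T)) (A B C : set T) (p : T) :
  critical_triple H A B C p -> critical_triple H B A C p.
Proof.
move=> [[HA HB HC] [Ap Bp Cp] only least]; split=> //.
- move=> Z HZ /(only Z HZ)[]->; by [constructor 2|constructor 1|constructor 3].
- move=> X Y Z HX HY HZ cov sub; apply: (least X Y Z) => // q Xq Yq Zq.
  by have [] := sub q Xq Yq Zq.
Qed.

(** Were [d b] negative, replacing [A] by the half-plane of [d] would give a
    covering triple with a smaller intersection, missing [p]. *)
Lemma minimal_triple_two_vertices (R : realType) (H : set (set (R * R)))
    (A B C : set (R * R)) (a b c p : R * R) (d : R * R * R) :
  frame A B C a b c -> critical_triple H A B C p ->
  H (half_plane d) -> aff d p < 0 -> aff d c < 0 ->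
  0 <= aff d a -> aff d b <= aff d a -> 0 <= aff d b.
Proof.
move=> fr [[HA HB HC] _ _ least] Hd dp dc da dba.
rewrite leNgt; apply/negP => db.
have dca : aff d c <= aff d a by lra.
have cov := frame_exchange fr da dba dca.
have : half_plane d p.
  apply: (least _ _ _ Hd HB HC cov) => q dq Bq Cq; split=> //.
  exact: (frame_exchange_shrinks fr da db dc dq Bq Cq).
by rewrite /half_plane /= leNgt dp.
Qed.

(** Let [u] be the point where the line from [c] through [p] meets the edge
    [ab].  Points just beyond [u] are outside [C], so some member other than [A], [B],
    [C] contains points arbitrarily close to [u], and by finiteness one of them
    contains [u].  It avoids [p], which is between [u] and [c], hence it avoids
    [c]; it contains one of [a] and [b], hence both by minimality. *)
Lemma edge_half_plane (R : realType) (H : set (set (R * R)))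
    (s : seq (R * R * R)) (A B C : set (R * R)) (a b c p : R * R) :
  (forall Z, H Z <-> exists2 k, k \in s & Z = half_plane k) ->
  survives_two_removals H ->
  frame A B C a b c -> critical_triple H A B C p ->
  exists d, [/\ H (half_plane d), aff d p < 0,
    0 <= aff d a, 0 <= aff d b & aff d c < 0].
Proof.
move=> Hs H3 fr crit; have [spn side] := fr.
have [_ [Ap Bp Cp] only _] := crit.
have [x [y [z [s1 pE]]]] := spn p.
have [Ax By Cz] := side _ _ _ s1.
have x0 : 0 <= x by apply/Ax; rewrite -pE.
have y0 : 0 <= y by apply/By; rewrite -pE.
have z0 : 0 <= z by apply/Cz; rewrite -pE.
have [x' [y' [x'0 y'0 s1' xE yE]]] : exists x' y',
    [/\ 0 <= x', 0 <= y', x' + y' = 1, x = (x + y) * x' & y = (x + y) * y'].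
  have [xy|xy] := eqVneq (x + y) 0.
    (* Here [p] is [c], and any point of the edge will do. *)
    exists 1, 0; rewrite xy; split; lra.
  exists (x / (x + y)), (y / (x + y)).
  have xy0 : 0 <= x + y by lra.
  split; rewrite ?divr_ge0 //; by field.
pose u := comb x' a y' b 0 c.
have s1'' : x' + y' + 0 = 1 by rewrite addr0.
have uE k : aff k u = x' * aff k a + y' * aff k b.
  by rewrite /u aff_comb // mul0r addr0.
have [d ds /andP[dp du]] : exists2 d, d \in s & (aff d p < 0) && (0 <= aff d u).
  apply: contrapT => none.
  have [|e e0 He] := @exists_strict_perturbation R
      [seq k <- s | aff k p < 0] u (comb 2 u (-1) c 0 u).
    move=> k; rewrite mem_filter => /andP[kp ks]; rewrite ltNge; apply/negP => ku.
    by apply: none; exists k => //; rewrite kp.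
  set v := comb (1 - e) _ _ _ _ _ in He.
  have vE : v = comb ((1 + e) * x') a ((1 + e) * y') b (- e) c.
    by rewrite /v /u /comb /=; congr pair; ring.
  have sv : (1 + e) * x' + (1 + e) * y' + - e = 1.
    by rewrite -mulrDr s1'; ring.
  have nCv : ~ C v.
    rewrite vE; have [_ _ ->] := side _ _ _ sv.
    by apply/negP; rewrite -ltNge oppr_lt0.
  have [Z [HZ Zv ZA ZB]] := H3 A B v.
  have ZC : Z <> C by move=> ZC; apply: nCv; rewrite -ZC.
  have [k ks Zk] := (Hs Z).1 HZ.
  have kp : aff k p < 0.
    by apply/not_half_plane; rewrite -Zk => /(only _ HZ)[].
  have : aff k v < 0 by apply: He; rewrite mem_filter kp.
  by move/not_half_plane; rewrite -Zk.
have Hd : H (half_plane d) by apply/Hs; exists d.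
have dpE : aff d p = (x + y) * aff d u + z * aff d c.
  have xd : x * aff d a = (x + y) * x' * aff d a by rewrite -xE.
  have yd : y * aff d b = (x + y) * y' * aff d b by rewrite -yE.
  by rewrite pE aff_comb // uE xd yd; ring.
have dc : aff d c < 0.
  rewrite ltNge; apply/negP => dc; move: dp; rewrite dpE ltNge => /negP; apply.
  by apply: addr_ge0; apply: mulr_ge0 => //; apply: addr_ge0.
have du' : 0 <= x' * aff d a + y' * aff d b by rewrite -uE.
have [dba|dab] := leP (aff d b) (aff d a).
  have da : 0 <= aff d a.
    rewrite -[aff d a]mul1r -s1' mulrDl.
    by apply: le_trans du' _; rewrite lerD2l ler_wpM2l.
  exists d; split=> //.
  exact: (minimal_triple_two_vertices fr crit Hd dp dc da dba).
have db : 0 <= aff d b.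
  rewrite -[aff d b]mul1r -s1' mulrDl.
  by apply: le_trans du' _; rewrite lerD2r ler_wpM2l // ltW.
exists d; split=> //.
exact: (minimal_triple_two_vertices (frame_swap fr)
  (critical_triple_swap crit) Hd dp dc db (ltW dab)).
Qed.

(** Close to [p] in the direction of [pa], a point is outside the members that
    avoid [p] and outside the half-planes of [g] and [h]: only that of [f] can
    cover it. *)
Lemma concurrent_not_critical (R : realType) (H : set (set (R * R)))
    (s : seq (R * R * R)) (f g h : R * R * R) (pa p : R * R) :
  (forall Z, H Z <-> exists2 k, k \in s & Z = half_plane k) ->
  survives_two_removals H ->
  critical_triple H (half_plane f) (half_plane g) (half_plane h) p ->
  aff g pa < 0 -> aff h pa < 0 -> aff g p = 0 -> aff h p = 0 -> False.
Proof.
move=> Hs H3 [_ _ only _] ga ha gp hp.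
have [|e e0 He] := @exists_strict_perturbation R
    [seq k <- s | aff k p < 0] p pa.
  by move=> k; rewrite mem_filter => /andP[].
set r := comb _ _ _ _ _ _ in He.
have rE k : aff k p = 0 -> aff k r < 0 <-> aff k pa < 0.
  move=> kp; rewrite /r aff_comb; last ring.
  by rewrite kp !mulr0 add0r addr0 pmulr_rlt0.
have [Z [HZ Zr Zf _]] := H3 (half_plane f) (half_plane f) r.
have [k ks Zk] := (Hs Z).1 HZ.
have [Zp|Zp] := pselect (Z p); last first.
  suff : aff k r < 0 by move/not_half_plane; rewrite -Zk.
  by apply: He; rewrite mem_filter ks andbT; apply/not_half_plane; rewrite -Zk.
have [//|ZE|ZE] := only Z HZ Zp.
- by move: Zr; rewrite ZE; apply/not_half_plane/rE.
- by move: Zr; rewrite ZE; apply/not_half_plane/rE.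
Qed.

(** * Two disjoint covering triples *)

Lemma decomposable_of_edges (R : realType) (H : set (set (R * R)))
    (A B C : set (R * R)) (a b c p : R * R) (d e f : R * R * R) :
  frame A B C a b c -> critical_triple H A B C p ->
  [/\ H (half_plane d), aff d p < 0, 0 <= aff d a, 0 <= aff d b & aff d c < 0] ->
  [/\ H (half_plane e), aff e p < 0, 0 <= aff e b, 0 <= aff e c & aff e a < 0] ->
  [/\ H (half_plane f), aff f p < 0, 0 <= aff f c, 0 <= aff f a & aff f b < 0] ->
  aff d b <= aff d a -> aff e c <= aff e b ->
  decomposable_into_two_covers H.
Proof.
move=> fr [[HA HB HC] [Ap Bp Cp] only _] [Hd dp da db dc] [He ep eb ec ea]
  [Hf fp fc fa fb] dba ecb.
have notp k : aff k p < 0 -> ~ half_plane k p by move/not_half_plane.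
have sep k k' q : aff k q < 0 -> 0 <= aff k' q -> half_plane k' <> half_plane k.
  by move=> /not_half_plane kq k'q E; apply: kq; rewrite -E.
have meets (Z : set (R * R)) k : Z p -> aff k p < 0 -> Z <> half_plane k.
  by move=> Zp kp E; apply: (notp _ kp); rewrite -E.
have [AB AC] : A <> B /\ A <> C.
  (* A point beyond the side [bc] is in [B] and [C] but not in [A]. *)
  have [_ side] := fr.
  have [|Ax By Cz] := side (-1) 1 1; first ring.
  have nA : ~ A (comb (-1) a 1 b 1 c).
    by rewrite Ax; apply/negP; rewrite -ltNge ltrN10.
  split=> E; apply: nA; rewrite E; [apply/By|apply/Cz]; exact: ler01.
have dca : aff d c <= aff d a by lra.
apply: (@decomposable_of_triples _ H (half_plane d) B C
  A (half_plane e) (half_plane f)).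
- by [].
- by [].
- exact: frame_exchange fr da dba dca.
- exact: opposite_side_cover fr Ap Bp Cp eb ec ecb fb fc ep fp.
- by split=> //; apply: meets.
- by split; [exact: sep dc ec|apply/nesym/meets|apply/nesym/meets].
- by split; [exact: sep dc fc|apply/nesym/meets|apply/nesym/meets].
Qed.

Lemma frame_decomposable (R : realType) (H : set (set (R * R)))
    (s : seq (R * R * R)) (A B C : set (R * R)) (a b c p : R * R) :
  (forall Z, H Z <-> exists2 k, k \in s & Z = half_plane k) ->
  survives_two_removals H ->
  frame A B C a b c -> critical_triple H A B C p ->
  decomposable_into_two_covers H.
Proof.
move=> Hs H3 frA critA.
have frB := frame_rot frA; have critB := critical_triple_rot critA.
have frC := frame_rot frB; have critC := critical_triple_rot critB.
have frA' := frame_swap frC; have critA' := critical_triple_swap critC.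
have frB' := frame_swap frA; have critB' := critical_triple_swap critA.
have frC' := frame_swap frB; have critC' := critical_triple_swap critB.
have [d hd] := edge_half_plane Hs H3 frA critA.
have [e he] := edge_half_plane Hs H3 frB critB.
have [f hf] := edge_half_plane Hs H3 frC critC.
have rev k u v w : [/\ H (half_plane k), aff k p < 0, 0 <= aff k u,
    0 <= aff k v & aff k w < 0] -> [/\ H (half_plane k), aff k p < 0,
    0 <= aff k v, 0 <= aff k u & aff k w < 0] by case.
have hd' := rev _ _ _ _ hd; have he' := rev _ _ _ _ he; have hf' := rev _ _ _ _ hf.
(* Two of the three edges have the same orientation.  The primed frames reverse
   the cyclic order, for the case where the common orientation is the other
   one. *)
have [dab|/ltW dab] := leP (aff d b) (aff d a);
have [ebc|/ltW ebc] := leP (aff e c) (aff e b);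
have [fca|/ltW fca] := leP (aff f a) (aff f c).
- exact: decomposable_of_edges frA critA hd he hf dab ebc.
- exact: decomposable_of_edges frA critA hd he hf dab ebc.
- exact: decomposable_of_edges frC critC hf hd he fca dab.
- exact: decomposable_of_edges frA' critA' hf' he' hd' fca ebc.
- exact: decomposable_of_edges frB critB he hf hd ebc fca.
- exact: decomposable_of_edges frB' critB' hd' hf' he' dab fca.
- exact: decomposable_of_edges frC' critC' he' hd' hf' ebc dab.
- exact: decomposable_of_edges frB' critB' hd' hf' he' dab fca.
Qed.

Lemma exists_critical_triple (R : realType) (H : set (set (R * R)))
    (s : seq (R * R * R)) :
  (forall Z, H Z <-> exists2 k, k \in s & Z = half_plane k) ->
  survives_two_removals H ->
  ~ decomposable_into_two_covers H ->
  exists A B C p, critical_triple H A B C p /\ cover3 A B C.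
Proof.
move=> Hs H3 nodec.
pose core (t : set (R * R) * set (R * R) * set (R * R)) :=
  t.1.1 `&` t.1.2 `&` t.2.
pose P := core @` [set t | [/\ H t.1.1, H t.1.2, H t.2 & cover3 t.1.1 t.1.2 t.2]].
have finH : finite_set H.
  apply/finite_seqP; exists [seq half_plane k | k <- s].
  apply/seteqP; split=> Z /=.
    by move/Hs => [k ks ->]; apply: map_f.
  by move/mapP => [k ks ->]; apply/Hs; exists k.
have finP : finite_set P.
  apply/finite_image/(@sub_finite_set _ _ (H `*` H `*` H)).
    by move=> [[X Y] Z] [].
  by apply: finite_setX => //; apply: finite_setX.
have P0 : P !=set0.
  have [|q|A [B [C [As Bs Cs cov]]]] := @helly_cover R [seq half_plane k | k <- s].
  - by move=> _ /mapP[k _ ->]; exists k.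
  - have [Z [HZ Zq _ _]] := H3 set0 set0 q; exists Z => //.
    by have [k ks ->] := (Hs Z).1 HZ; apply: map_f.
  have inH Z : Z \in [seq half_plane k | k <- s] -> H Z.
    by move/mapP => [k ks ->]; apply/Hs; exists k.
  by exists (core (A, B, C)), (A, B, C) => //; split=> //=; apply: inH.
have [_ [[[A B] C] /= [HA HB HC cov] <-] least] := finite_set_minimal finP P0.
have [p only] : exists p, forall Z, H Z -> Z p -> [\/ Z = A, Z = B | Z = C].
  apply: contrapT => /forallNP none; apply: nodec.
  apply: (@decomposable_of_subcover _ _ [set Z | [\/ Z = A, Z = B | Z = C]]).
  - by move=> Z [] ->.
  - exact: is_cover_triple.
  - move=> q; apply: contrapT => /forallNP noZ; apply: (none q) => Z HZ Zq.
    by apply: contrapT => nZ; apply: (noZ Z).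
have Ap : A p by have [Z [HZ Zp ZB ZC]] := H3 B C p; have [<-| |] := only Z HZ Zp.
have Bp : B p by have [Z [HZ Zp ZA ZC]] := H3 A C p; have [|<-|] := only Z HZ Zp.
have Cp : C p by have [Z [HZ Zp ZA ZB]] := H3 A B p; have [| |<-] := only Z HZ Zp.
exists A, B, C, p; split=> //; split=> // X Y Z HX HY HZ covXYZ sub.
have XYZ : core (X, Y, Z) = core (A, B, C).
  apply: least; first by exists (X, Y, Z).
  by move=> q [[Xq Yq] Zq]; have [] := sub q Xq Yq Zq.
have : core (A, B, C) p by [].
by rewrite -XYZ => -[[]].
Qed.

Theorem corollary2 (R : realType) (H : set (set (R * R))) :
  finite_set H ->
  (forall A : set (R * R), H A -> closed_half_plane A) ->
  fold_covering 3 H ->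
  decomposable_into_two_covers H.
Proof.
move=> finH Hhp /fold_covering_survives H3; apply: contrapT => nodec.
have [s Hs] : exists s : seq (R * R * R),
    forall Z, H Z <-> exists2 k, k \in s & Z = half_plane k.
  have [l lH] := (finite_seqP _).1 finH.
  have /choice[k hk] : forall Z, exists k, H Z -> Z = half_plane k.
    move=> Z; have [/Hhp/closed_half_planeP[k ->]|nHZ] := pselect (H Z).
      by exists k.
    by exists (0, 0, 0).
  exists [seq k Z | Z <- l] => Z; split=> [HZ|[_ /mapP[Y Yl ->] ->]].
    by exists (k Z); [apply: map_f; move: HZ; rewrite lH|apply: hk].
  have HY : H Y by rewrite lH.
  by rewrite -(hk Y HY).
have [A [B [C [p [crit cov]]]]] := exists_critical_triple Hs H3 nodec.
have [[HA HB HC] [Ap Bp Cp] _ _] := crit.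
have private X Y : H X -> H Y -> exists q, ~ X q /\ ~ Y q.
  move=> HX HY; apply: contrapT => /forallNP noq; apply: nodec.
  apply: (two_cover_decomposable H3 HX HY) => q.
  by have /not_andP[] := noq q => /contrapT; [left|right].
have [f _ Af] := (Hs A).1 HA; have [g _ Bg] := (Hs B).1 HB.
have [h _ Ch] := (Hs C).1 HC; subst A B C.
have [pa [/not_half_plane ga /not_half_plane ha]] := private _ _ HB HC.
have [pb [/not_half_plane fb /not_half_plane hb]] := private _ _ HA HC.
have [pc [/not_half_plane fc /not_half_plane gc]] := private _ _ HA HB.
have [[a [b [c fr]]]|[q [fq gq hq]]] := frame_or_concurrent cov ga ha fb hb fc gc.
  by apply: nodec; apply: frame_decomposable Hs H3 fr crit.
have gp : aff g p = 0.
  exact: concurrent_common_point (cover3_rot cov) hb fb (And3 gq hq fq) Bp Cp Ap.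
have hp : aff h p = 0.
  have cov' := cover3_rot (cover3_rot cov).
  exact: concurrent_common_point cov' fc gc (And3 hq fq gq) Cp Ap Bp.
exact: (concurrent_not_critical Hs H3 crit ga ha gp hp).
Qed.
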